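(* Let $F_2$ be a free group on two generators. The set $\mathcal{BO}(F_2)$ of bi-orders of $F_2$ cannot be presented in the form $$\mathcal{BO}(F_2)=\bigcup_{n\in\mathbb{N}}\overline{\mathrm{Aut}(F_2)(<_n)},$$ for any sequence $(<_n)_{n\in\mathbb{N}}$ of bi-orders $<_n\,\in\mathcal{BO}(F_2)$, where $\overline{\mathrm{Aut}(F_2)(<_n)}$ denotes the closure in $\mathcal{BO}(F_2)$ of the orbit of $<_n$ under the natural action of $\mathrm{Aut}(F_2)$.
   Context: A bi-order on a group $G$ is a (strict) total order $<$ on $G$ that is invariant under left and right multiplication. Its positive cone is $P_<=\{g\in G: g>1\}$. The set $\mathcal{BO}(G)$ of all bi-orders on $G$ carries the topology whose base consists of the sets $U_S=\{<\,\in\mathcal{BO}(G) : S\subset P_<\}$, for finite $S\subset G$. An automorphism $\sigma\in\mathrm{Aut}(G)$ acts on $\mathcal{BO}(G)$ by sending $<$ to the bi-order $\sigma(<)$ with positive cone $\sigma(P_<)$. *)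

(* Defs.v *)
From HB Require Import structures.
From mathcomp Require Import all_boot.
From mathcomp Require Import all_classical topology.

Set Implicit Arguments.
Unset Strict Implicit.
Unset Printing Implicit Defensive.

Import Algebra.

Local Open Scope classical_set_scope.
Local Open Scope group_scope.

Section MultiplicativeTheory.
Variables (G H : groupType) (f : {multiplicative G -> H}).

Lemma mulmorph1 : f 1 = 1.
Proof. by apply: (mulgI (f 1)); rewrite -gmulfM !mulg1. Qed.

Lemma mulmorphV x : f x^-1 = (f x)^-1.
Proof. by apply: (mulgI (f x)); rewrite -gmulfM !mulgV mulmorph1. Qed.

End MultiplicativeTheory.

(** In a word, the letter [(x, false)] stands for the generator [x] and [(x, true)] for its
   inverse. *)

Section ReducedWords.
Variable T : eqType.
Implicit Types (a b : T * bool) (u v w : seq (T * bool)).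

Definition invl a : T * bool := (a.1, ~~ a.2).

Definition reduced w : bool := sorted (fun a b => b != invl a) w.

Definition consl a w :=
  if w is b :: w' then if b == invl a then w' else a :: w else [:: a].

Definition mulw u v := foldr consl v u.

Definition invw u := rev (map invl u).

Lemma invlK : involutive invl.
Proof. by case=> x b; rewrite /invl /= negbK. Qed.

Lemma reduced_behead a w : reduced (a :: w) -> reduced w.
Proof. exact: path_sorted. Qed.

Lemma reduced_consl a w : reduced w -> reduced (consl a w).
Proof.
case: w => [//|b w] /= rw; case: ifPn => [_|nba]; first exact: reduced_behead rw.
by rewrite /reduced /= nba.
Qed.

Lemma reduced_mulw u v : reduced v -> reduced (mulw u v).
Proof. by move=> rv; elim: u => //= a u IH; exact: reduced_consl. Qed.

Lemma consl_id a w : reduced (a :: w) -> consl a w = a :: w.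
Proof. by case: w => [//|b w] /= /andP[/negPf ->]. Qed.

Lemma conslK a w : reduced w -> consl a (consl (invl a) w) = w.
Proof.
case: w => [|b w] rw /=; first by rewrite eqxx.
rewrite invlK; case: eqP => [ba|_] /=; last by rewrite eqxx.
by rewrite -ba; exact: consl_id.
Qed.

Lemma mulw_consl a u v : reduced v -> mulw (consl a u) v = consl a (mulw u v).
Proof.
move=> rv; case: u => [//|b u] /=; case: eqP => [->|_] //=.
by rewrite conslK //; exact: reduced_mulw.
Qed.

Lemma mulwA u v w : reduced w -> mulw u (mulw v w) = mulw (mulw u v) w.
Proof. by move=> rw; elim: u => //= a u IH; rewrite mulw_consl // IH. Qed.

Lemma mulw0 u : reduced u -> mulw u [::] = u.
Proof.
elim: u => //= a u IH ru; rewrite IH; first exact: consl_id.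
exact: reduced_behead ru.
Qed.

Lemma mulVw u v : reduced v -> mulw (invw u) (mulw u v) = v.
Proof.
move=> rv; rewrite /invw; elim: u => //= a u IH.
rewrite rev_cons -cats1 /mulw foldr_cat /= -/(mulw u v).
by rewrite -{2}[a]invlK conslK ?IH //; exact: reduced_mulw.
Qed.

Lemma invwK : involutive invw.
Proof. by move=> u; rewrite /invw map_rev revK -map_comp (eq_map invlK) map_id. Qed.

Lemma reduced_invw u : reduced u -> reduced (invw u).
Proof.
rewrite /reduced /invw rev_sorted sorted_map; apply: sub_sorted => a b /=.
by apply: contraNneq => ->; rewrite invlK.
Qed.

End ReducedWords.

Section FreeGroup.
Variable T : choiceType.

Record freegroup := FreeGroup { word : seq (T * bool) ; _ : reduced word }.

HB.instance Definition _ := [isSub for word].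
HB.instance Definition _ := [Choice of freegroup by <:].

Lemma reduced_word (x : freegroup) : reduced (word x).
Proof. exact: valP x. Qed.

Definition fg_one : freegroup := @FreeGroup [::] isT.

Definition fg_mul (x y : freegroup) : freegroup :=
  FreeGroup (reduced_mulw (word x) (reduced_word y)).

Definition fg_inv (x : freegroup) : freegroup :=
  FreeGroup (reduced_invw (reduced_word x)).

Fact fg_mulA : associative fg_mul.
Proof. by move=> x y z; apply/val_inj/mulwA/reduced_word. Qed.

Fact fg_mul1 : left_id fg_one fg_mul.
Proof. by move=> x; apply/val_inj. Qed.

Fact fg_mulr1 : right_id fg_one fg_mul.
Proof. by move=> x; apply/val_inj/mulw0/reduced_word. Qed.

Fact fg_mulV : left_inverse fg_one fg_inv fg_mul.
Proof.
move=> x; apply/val_inj => /=; rewrite -[X in mulw _ X]mulw0 ?reduced_word //.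
exact: mulVw.
Qed.

Fact fg_mulrV : right_inverse fg_one fg_inv fg_mul.
Proof.
move=> x; rewrite -[X in fg_mul X _](_ : fg_inv (fg_inv x) = x) ?fg_mulV //.
by apply/val_inj/invwK.
Qed.

HB.instance Definition _ :=
  isGroup.Build freegroup fg_mulA fg_mul1 fg_mulr1 fg_mulV fg_mulrV.

Definition fgen (x : T) : freegroup := @FreeGroup [:: (x, false)] isT.

Section UniversalProperty.
Variable H : groupType.

Definition letterval (f : T -> H) (a : T * bool) : H :=
  if a.2 then (f a.1)^-1 else f a.1.

Definition fg_lift (f : T -> H) (x : freegroup) : H :=
  foldr (fun a h => letterval f a * h) 1 (word x).

Lemma letterval_invl f a : letterval f (invl a) = (letterval f a)^-1.
Proof. by case: a => x [] //=; rewrite /letterval /= invgK. Qed.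

Fact fg_liftM f : {morph fg_lift f : x y / x * y}.
Proof.
case=> [u ru] y; rewrite /fg_lift /=; elim: u {ru} => [|a u IH] /=.
  by rewrite mul1g.
rewrite -mulgA -IH; case: (mulw u _) => [//|b w] /=; case: eqP => [->|] //=.
by rewrite letterval_invl mulVKg.
Qed.

HB.instance Definition _ f :=
  isMultiplicative.Build freegroup H (fg_lift f) (fg_liftM f).

Lemma fg_lift_gen f x : fg_lift f (fgen x) = f x.
Proof. exact: mulg1. Qed.

Lemma fg_lift_uniq f (phi : {multiplicative freegroup -> H}) :
  (forall x, phi (fgen x) = f x) -> phi =1 fg_lift f.
Proof.
move=> phif.
case=> u; elim: u => [|a u IH] r.
  by rewrite (_ : FreeGroup r = 1) ?mulmorph1 //; exact/val_inj.
have ru := reduced_behead r.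
have -> : FreeGroup r =
    (if a.2 then (fgen a.1)^-1 else fgen a.1) * FreeGroup ru.
  apply/val_inj; rewrite /= -[LHS](consl_id r).
  by case: a {r} => x [].
rewrite !gmulfM IH; congr (_ * _).
by case: ifP => _; rewrite ?mulmorphV /= phif fg_lift_gen.
Qed.

End UniversalProperty.

End FreeGroup.

Definition F2 : groupType := freegroup bool.

Record biorder (G : groupType) := BiOrder {
  bolt : G -> G -> Prop ;
  bolt_irr : forall x, ~ bolt x x ;
  bolt_trans : forall y x z, bolt x y -> bolt y z -> bolt x z ;
  bolt_total : forall x y, [\/ x = y, bolt x y | bolt y x] ;
  boltM2l : forall z x y, bolt x y -> bolt (z * x) (z * y) ;
  boltM2r : forall z x y, bolt x y -> bolt (x * z) (y * z) }.

Definition poscone (G : groupType) (o : biorder G) : set G := [set g | bolt o 1 g].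

Section BiOrderTheory.
Variable G : groupType.
Implicit Types o : biorder G.

Lemma bolt_poscone o x y : bolt o x y <-> poscone o (x^-1 * y).
Proof.
split=> [/(boltM2l x^-1)|/(boltM2l x)]; rewrite /poscone /= ?mulVg //.
by rewrite mulg1 mulVKg.
Qed.

Lemma biorder_eq o o' : (forall x y, bolt o x y <-> bolt o' x y) -> o = o'.
Proof.
case: o o' => [lt ? ? ? ? ?] [lt' ? ? ? ? ?] /= E.
have {}E : lt = lt' by apply/funext => x; apply/funext => y; exact/propext.
by subst lt'; congr BiOrder; exact: Prop_irrelevance.
Qed.

Lemma poscone_inj : injective (@poscone G).
Proof.
move=> o o' E; apply: biorder_eq => x y.
by split=> /bolt_poscone h; apply/bolt_poscone; move: h; rewrite E.
Qed.

HB.instance Definition _ := gen_eqMixin (biorder G).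
HB.instance Definition _ := gen_choiceMixin (biorder G).

(** The sets [U_S]; they form the base of the topology for [S] finite. *)
Definition bo_base (S : set G) : set (biorder G) := [set o | S `<=` poscone o].

Fact bo_base_cover :
  \bigcup_(S in [set S | finite_set S]) bo_base S = [set: biorder G].
Proof.
apply/seteqP; split=> // o _; exists set0; first exact: finite_set0.
exact: sub0set.
Qed.

Fact bo_base_join (S S' : set G) o : finite_set S -> finite_set S' ->
  bo_base S o -> bo_base S' o ->
  exists S'', [/\ finite_set S'', bo_base S'' o
                & bo_base S'' `<=` bo_base S `&` bo_base S'].
Proof.
move=> fS fS' oS oS'; exists (S `|` S'); split.
- by rewrite finite_setU.
- by move=> x []; [exact: oS | exact: oS'].
- by move=> o' h; split=> x Sx; apply: h; [left | right].
Qed.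

HB.instance Definition _ := isBaseTopological.Build (biorder G)
  bo_base_cover bo_base_join.

Lemma nbhs_biorder o (A : set (biorder G)) :
  nbhs o A <-> exists S, [/\ finite_set S, bo_base S o & bo_base S `<=` A].
Proof.
split=> [[B [[D' D'fin <-] [S D'S oS] BA]]|[S [fS oS SA]]].
  exists S; split=> //; first exact: D'fin.
  by move=> o' o'S; apply: BA; exists S.
exists (bo_base S); split=> //.
exists [set S]; first by move=> _ ->.
by rewrite bigcup_set1.
Qed.

End BiOrderTheory.

Record automorphism (G : groupType) := Automorphism {
  aut_fun :> {multiplicative G -> G} ;
  aut_bij : bijective aut_fun }.

Section AutAction.
Variables (G : groupType) (s : automorphism G) (o : biorder G).

(** The bi-order with positive cone [s @` poscone o]. *)
Let lt (x y : G) : Prop := (s @` poscone o) (x^-1 * y).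

Let s_inj : injective s := bij_inj (aut_bij s).

Let s_surj x : exists y, x = s y.
Proof. by have [t _ tK] := aut_bij s; exists (t x); rewrite tK. Qed.

Let ltE x y : lt (s x) (s y) = bolt o x y.
Proof.
apply/propext; rewrite /lt -mulmorphV -gmulfM bolt_poscone.
by split=> [[z oz /s_inj <-]|oxy] //; exists (x^-1 * y).
Qed.

Fact aut_act_irr x : ~ lt x x.
Proof. by have [y ->] := s_surj x; rewrite ltE; exact: bolt_irr. Qed.

Fact aut_act_trans y x z : lt x y -> lt y z -> lt x z.
Proof.
have [x' ->] := s_surj x; have [y' ->] := s_surj y; have [z' ->] := s_surj z.
by rewrite !ltE; exact: bolt_trans.
Qed.

Fact aut_act_total x y : [\/ x = y, lt x y | lt y x].
Proof.
have [x' ->] := s_surj x; have [y' ->] := s_surj y; rewrite !ltE.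
by case: (bolt_total o x' y') => [->|?|?]; constructor.
Qed.

Fact aut_actM2l z x y : lt x y -> lt (z * x) (z * y).
Proof.
have [x' ->] := s_surj x; have [y' ->] := s_surj y; have [z' ->] := s_surj z.
by rewrite -!gmulfM !ltE; exact: boltM2l.
Qed.

Fact aut_actM2r z x y : lt x y -> lt (x * z) (y * z).
Proof.
have [x' ->] := s_surj x; have [y' ->] := s_surj y; have [z' ->] := s_surj z.
by rewrite -!gmulfM !ltE; exact: boltM2r.
Qed.

Definition aut_act : biorder G :=
  BiOrder aut_act_irr aut_act_trans aut_act_total aut_actM2l aut_actM2r.

Lemma poscone_aut_act : poscone aut_act = s @` poscone o.
Proof. by rewrite /poscone /= /lt; apply/seteqP; split=> x /=; rewrite invg1 mul1g. Qed.

End AutAction.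

Definition aut_orbit (G : groupType) (o : biorder G) : set (biorder G) :=
  range (fun s : automorphism G => aut_act s o).

(* Main.v *)
Require Import Defs.
From mathcomp Require Import all_boot.
From mathcomp Require Import all_classical topology.
From HB Require Import structures.
From mathcomp Require Import all_order ssralg ssrnum ssrint interval archimedean.
From mathcomp Require Import constructive_ereal reals exp lebesgue_measure.
From mathcomp Require Import ring lra.
From mathcomp Require Import Rstruct.

(** Write [a], [b] for the generators of [F_2] and [c = [a, b]].  The proof attaches to each
   bi-order in a certain nonempty open set an invariant real number which takes at most one
   value on each orbit and uncountably many values overall.

   Let [<] be a bi-order with [1 < c] for which every conjugate of [c] lies in the archimedean
   class of [c].  The ratio of the sizes of [c ^ g] and [c], a positive real defined by
   comparing powers, is multiplicative in [g] (the chain rule [ratioM]) and does not change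
   when [c] is replaced by another element of its archimedean class ([scale_base]).  Its
   logarithm is a homomorphism [v : F_2 -> R], that is, a vector of [R^2].  If moreover
   [b > 1] and [c ^ b] is at least [c ^+ 2], then the elements of the commutator subgroup,
   which are bounded by powers of [c], are all smaller than [b].  If also [b ^+ 4 < a], the
   order induces on the abelianization [Z^2] a half-plane order, given up to the boundary by a
   second linear form [w], normalised by [w a = 1].  An automorphism acts on [Z^2] by a matrix
   of determinant [1] or [-1], which transforms [v] linearly (the base change uses that the
   image of [c] is again in the archimedean class of [c]) and [w] linearly up to a positive
   factor.  On the pairs [(v, w)] of positive determinant, [w] being taken up to a positive
   factor, the group [SL_2(R)] acts simply transitively, so its discrete subgroup [SL_2(Z)] acts
   properly discontinuously, while its orbits on the forms [v] alone may be dense.  The nine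
   inequalities of [pinched] confine [(v, w)] to a region so small that only the identity
   matrix maps a point of it into it ([matrix_eq1]).  Hence two pinched bi-orders in one orbit
   have the same [v] ([pinched_rigid]), and, these inequalities being open, [v] keeps its value
   at the pinched points of the closure of the orbit ([closure_scale]).

   On the other hand every [t] strictly between [2] and [5/2] is the value of [exp (v b)] for
   some pinched bi-order ([lex_affine]): compare first the exponent sums of [a], then the
   images under the affine representation sending [a] to [x + 1] and [b] to [t x], and break
   ties with a term of the given sequence of bi-orders.  A countable union of orbit closures can
   account for countably many [t] only. *)

Set Implicit Arguments.
Unset Strict Implicit.
Unset Printing Implicit Defensive.

Import Order.TTheory GRing.Theory Num.Theory.
Import nmodule.Algebra.

Local Open Scope classical_set_scope.
Local Open Scope group_scope.

(** * Inequalities in a bi-ordered group *)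

Section OrderTheory.
Variables (G : groupType) (o : biorder G).
Implicit Types x y z : G.

Definition bole x y : Prop := x = y \/ bolt o x y.

Lemma bolt_asym x y : bolt o x y -> ~ bolt o y x.
Proof. by move=> xy yx; apply: (bolt_irr (bolt_trans xy yx)). Qed.

Lemma boltW x y : bolt o x y -> bole x y.
Proof. by right. Qed.

Lemma bolexx x : bole x x.
Proof. by left. Qed.

Lemma bole_ngt x y : bole x y -> ~ bolt o y x.
Proof. by case=> [->|/bolt_asym//]; exact: bolt_irr. Qed.

Lemma boltP x y : bolt o x y \/ bole y x.
Proof. by case: (bolt_total o x y) => [->||]; [right; left|left|right; right]. Qed.

Lemma bole_lt_trans y x z : bole x y -> bolt o y z -> bolt o x z.
Proof. by case=> [->//|]; apply: bolt_trans. Qed.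

Lemma bolt_le_trans y x z : bolt o x y -> bole y z -> bolt o x z.
Proof. by move=> xy [<-//|]; apply: bolt_trans xy. Qed.

Lemma bole_trans y x z : bole x y -> bole y z -> bole x z.
Proof. by move=> xy [<-//|yz]; apply/boltW/(bole_lt_trans xy). Qed.

Lemma boltM x y z w : bolt o x y -> bolt o z w -> bolt o (x * z) (y * w).
Proof. by move=> xy zw; apply: bolt_trans (boltM2r _ xy) _; apply: boltM2l. Qed.

Lemma boleM2l z x y : bole x y -> bole (z * x) (z * y).
Proof. by case=> [->|/(boltM2l z)/boltW//]; apply: bolexx. Qed.

Lemma boleM2r z x y : bole x y -> bole (x * z) (y * z).
Proof. by case=> [->|/(boltM2r z)/boltW//]; apply: bolexx. Qed.

Lemma boleM x y z w : bole x y -> bole z w -> bole (x * z) (y * w).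
Proof. by move=> xy zw; apply: bole_trans (boleM2r _ xy) _; apply: boleM2l. Qed.

Lemma bolt_conj z x y : bolt o x y -> bolt o (x ^ z) (y ^ z).
Proof. by move=> xy; rewrite !conjgE; apply/boltM2l/boltM2r. Qed.

Lemma bole_conj z x y : bole x y -> bole (x ^ z) (y ^ z).
Proof. by move=> xy; rewrite !conjgE; apply/boleM2l/boleM2r. Qed.

Lemma boltV x y : bolt o x y -> bolt o y^-1 x^-1.
Proof. by move=> /(boltM2l x^-1)/(boltM2r y^-1); rewrite mulVg mul1g mulgK. Qed.

Lemma boleV x y : bole x y -> bole y^-1 x^-1.
Proof. by case=> [->|/boltV/boltW//]; apply: bolexx. Qed.

Lemma boleX x y n : bole x y -> bole (x ^+ n) (y ^+ n).
Proof.
by move=> xy; elim: n => [|n IH]; [exact: bolexx | rewrite !expgS; apply: boleM].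
Qed.

Lemma boltX x y n : 0 < n -> bolt o x y -> bolt o (x ^+ n) (y ^+ n).
Proof.
case: n => // n _ xy; rewrite !expgS; apply: bolt_le_trans (boltM2r _ xy) _.
by apply/boleM2l/boleX/boltW.
Qed.

Lemma bole1X x n : bole 1 x -> bole 1 (x ^+ n).
Proof. by move=> /(@boleX _ _ n); rewrite expg1n. Qed.

Lemma bole_wX2l x m n : bole 1 x -> m <= n -> bole (x ^+ m) (x ^+ n).
Proof.
move=> x1 /subnKC <-; rewrite expgnDr -{1}[x ^+ m]mulg1.
exact/boleM2l/bole1X.
Qed.

Lemma bole_X2l x m n : bolt o 1 x -> bole (x ^+ m) (x ^+ n) -> m <= n.
Proof.
move=> x1 le; rewrite leqNgt; apply/negP => nm; apply: (bole_ngt le).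
rewrite -(subnKC nm) addSn -addnS expgnDr -{1}[x ^+ n]mulg1; apply: boltM2l.
by rewrite -(expg1n _ (m - n.+1).+1); apply: boltX.
Qed.

End OrderTheory.

(** * Archimedean classes and the ratio of two elements *)

Section ArchimedeanClass.
Variables (G : groupType) (o : biorder G).
Implicit Types x y z : G.

Definition arch x y : Prop :=
  [/\ bolt o 1 x, bolt o 1 y, exists k, bole o x (y ^+ k)
    & exists k, bole o y (x ^+ k)].

Lemma arch_sym x y : arch x y -> arch y x.
Proof. by case. Qed.

Lemma arch_trans y x z : arch x y -> arch y z -> arch x z.
Proof.
case=> x1 y1 [k xy] [l yx] [_ z1 [m yz] [n zy]]; split=> //.
- exists (m * k)%N; apply: bole_trans xy _; rewrite expgnA; exact: boleX.
- exists (l * n)%N; apply: bole_trans zy _; rewrite expgnA; exact: boleX.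
Qed.

Lemma arch_refl x : bolt o 1 x -> arch x x.
Proof. by move=> x1; split=> //; exists 1%N; exact: bolexx. Qed.

Lemma arch_conj g x y : arch x y -> arch (x ^ g) (y ^ g).
Proof.
case=> x1 y1 [k xy] [l yx]; split.
- by rewrite -(conj1g g); apply: bolt_conj.
- by rewrite -(conj1g g); apply: bolt_conj.
- by exists k; rewrite -conjXg; apply: bole_conj.
- by exists l; rewrite -conjXg; apply: bole_conj.
Qed.

Section Ratio.
Variable R : realType.
Local Open Scope ring_scope.

Definition ratio x y : R :=
  sup [set r | exists k n : nat,
    [/\ (0 < n)%N, bole o (x ^+ k)%g (y ^+ n)%g & r = k%:R / n%:R]].

Lemma ratio_ge x y k n : arch x y ->
  bole o (y ^+ n)%g (x ^+ k)%g -> n%:R * ratio x y <= k%:R.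
Proof.
case=> x1 y1 _ _ yx.
case: n yx => [|n] yx; first by rewrite mul0r.
rewrite mulrC -ler_pdivlMr ?ltr0n //; apply: ge_sup.
  by exists 0, 0%N, 1%N; split=> //; rewrite ?mul0r // expg0; apply: bole1X; apply: boltW.
move=> _ [k' [n' [n'0 xy ->]]].
rewrite ler_pdivrMr ?ltr0n // mulrAC ler_pdivlMr ?ltr0n // -!natrM ler_nat.
apply: (bole_X2l x1); rewrite expgnA.
apply: bole_trans (boleX _ xy) _; rewrite expgnAC [X in bole _ _ X]expgnA.
exact: boleX.
Qed.

Lemma ratio_le x y k n : arch x y ->
  bole o (x ^+ k)%g (y ^+ n)%g -> k%:R <= n%:R * ratio x y.
Proof.
move=> xyA; have [x1 y1 _ [K yx]] := xyA => xy.
case: n xy => [|n] xy.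
  by rewrite mul0r lern0 -leqn0; apply: (bole_X2l x1).
rewrite mulrC -ler_pdivrMr ?ltr0n //; apply: ub_le_sup; last by exists k, n.+1.
exists K%:R => _ [k' [n' [n'0 xy' ->]]].
rewrite ler_pdivrMr ?ltr0n // -natrM ler_nat; apply: (bole_X2l x1).
by apply: bole_trans xy' _; rewrite expgnA; apply: boleX.
Qed.

Lemma archi_le0 (u v : R) : (forall m : nat, m%:R * u <= v) -> u <= 0.
Proof.
move=> uv; rewrite leNgt; apply/negP => u0.
have := uv (Num.truncn (v / u)).+1.
rewrite -ler_pdivlMr // leNgt.
by rewrite truncnS_gt.
Qed.

(** Were [r1 < r2], some [n] and [k] would satisfy [n * r1 < k < n * r2]; the order being total,
   [x ^+ k <= y ^+ n] or [y ^+ n <= x ^+ k], and each case is excluded.  Since the ratio itself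
   satisfies both hypotheses, this determines a ratio from the comparisons of powers. *)
Lemma bound_le x y (r1 r2 : R) : bolt o 1 x -> bolt o 1 y -> 0 <= r1 ->
  (forall k n : nat, bole o (x ^+ k)%g (y ^+ n)%g -> k%:R <= n%:R * r1) ->
  (forall k n : nat, bole o (y ^+ n)%g (x ^+ k)%g -> n%:R * r2 <= k%:R) ->
  r2 <= r1.
Proof.
move=> x1 y1 r10 up low; rewrite -subr_le0; apply: (@archi_le0 _ 1) => n.
set k := Num.truncn (n%:R * r1).
have lt : n%:R * r1 < k.+1%:R := truncnS_gt _.
have ge : k%:R <= n%:R * r1 by rewrite truncn_le mulr_ge0 ?ler0n.
have /low : bole o (y ^+ n)%g (x ^+ k.+1)%g.
  by case: (boltP o (x ^+ k.+1)%g (y ^+ n)%g) => // /boltW /up; rewrite leNgt lt.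
rewrite -addn1 natrD; lra.
Qed.

Lemma ratio_gt0 x y : arch x y -> 0 < ratio x y.
Proof.
move=> xyA; have [x1 y1 [k xy] _] := xyA.
have /(ratio_le xyA) : bole o (x ^+ 1)%g (y ^+ k)%g by [].
move=> h; have : 0 < k%:R * ratio x y by apply: lt_le_trans h.
by apply: contraPP => /negP; rewrite -leNgt => r0; apply/negP; rewrite -leNgt mulr_ge0_le0 ?ler0n.
Qed.

Lemma ratioxx x : bolt o 1 x -> ratio x x = 1.
Proof.
move=> x1; have xx := arch_refl x1; apply/le_anti/andP; split.
  by have := ratio_ge xx (@bolexx _ o (x ^+ 1)%g); rewrite mul1r.
by have := ratio_le xx (@bolexx _ o (x ^+ 1)%g); rewrite mul1r.
Qed.

(** Insert between powers of [x] and [z] a power of [y], the exponent being rounded to an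
   integer; raising everything to the power [m] makes the rounding error negligible. *)
Lemma ratio_mul_le x y z : arch x y -> arch y z ->
  ratio x z <= ratio x y * ratio y z.
Proof.
move=> xy yz; have [x1 y1 _ _] := xy; have [_ z1 _ _] := yz.
have rxy := ratio_gt0 xy; have ryz := ratio_gt0 yz.
apply: (bound_le x1 z1); first by rewrite mulr_ge0 // ltW.
  move=> k n kn; rewrite -subr_le0; apply: (@archi_le0 _ (n%:R * ratio x y)) => m.
  set j := Num.truncn (m%:R * ratio y z).
  have lt : m%:R * ratio y z < j.+1%:R := truncnS_gt _.
  have ge : j%:R <= m%:R * ratio y z by rewrite truncn_le mulr_ge0 ?ler0n // ltW.
  have zy : bole o (z ^+ m)%g (y ^+ j.+1)%g.
    case: (boltP o (y ^+ j.+1)%g (z ^+ m)%g) => // /boltW /(ratio_le yz).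
    by rewrite leNgt lt.
  have : bole o (x ^+ (k * m))%g (y ^+ (j.+1 * n))%g.
    rewrite !expgnA; apply: bole_trans (boleX _ kn) _.
    rewrite [X in bole _ X]expgnAC.
    exact: boleX.
  move=> /(ratio_le xy); rewrite !natrM -addn1 natrD.
  have : j%:R * (n%:R * ratio x y) <= m%:R * ratio y z * (n%:R * ratio x y).
    by rewrite ler_wpM2r // mulr_ge0 ?ler0n // ltW.
  nra.
by move=> k n; apply: ratio_ge; apply: arch_trans xy yz.
Qed.

Lemma ratioC x y : arch x y -> ratio x y * ratio y x = 1.
Proof.
move=> xy; have yx := arch_sym xy; have [x1 y1 _ _] := xy.
have rxy := ratio_gt0 xy; have ryx := ratio_gt0 yx.
apply/le_anti/andP; split; last first.
  by rewrite -(ratioxx x1); apply: ratio_mul_le.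
rewrite -ler_pdivlMr // div1r; apply: (bound_le x1 y1).
- by rewrite invr_ge0 ltW.
- by move=> k n kn; rewrite ler_pdivlMr //; apply: ratio_ge.
- by move=> k n; apply: ratio_ge.
Qed.

(** The chain rule; the converse of [ratio_mul_le] follows from [ratio_mul_le] for [x, z, y]
   because ratios in opposite directions are inverse to each other. *)
Lemma ratioM x y z : arch x y -> arch y z -> ratio x z = ratio x y * ratio y z.
Proof.
move=> xy yz; apply/le_anti; rewrite ratio_mul_le //=.
have zy := arch_sym yz; have := ratio_mul_le (arch_trans xy yz) zy.
rewrite -(ler_pM2r (ratio_gt0 yz)) -mulrA ratioC //.
by rewrite mulr1.
Qed.

Lemma ratio_conj g x y : ratio (x ^ g)%g (y ^ g)%g = ratio x y.
Proof.
congr sup; apply/seteqP; split=> r [k [n [n0 xy ->]]]; exists k, n; split=> //.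
  by move: xy; rewrite -!conjXg => /(@bole_conj _ o g^-1%g); rewrite !conjgK.
by rewrite -!conjXg; apply: bole_conj.
Qed.

End Ratio.
End ArchimedeanClass.

(** * Commutators and exponent sums in a free group *)

Lemma freegroup_ind (T : choiceType) (P : freegroup T -> Prop) :
  P 1 -> (forall x g, P g -> P (fgen x * g)) ->
  (forall x g, P g -> P ((fgen x)^-1 * g)) -> forall g, P g.
Proof.
move=> P1 Pg PV [u]; elim: u => [|a u IH] r.
  by rewrite (_ : FreeGroup r = 1) //; exact/val_inj.
have ru := reduced_behead r.
have -> : FreeGroup r =
    (if a.2 then (fgen a.1)^-1 else fgen a.1) * FreeGroup ru.
  by apply/val_inj; rewrite /= -[LHS](consl_id r); case: a {r} => x [].
by case: (a.2); [apply: PV | apply: Pg].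
Qed.

Definition normal_subgroup (G : groupType) (D : G -> Prop) : Prop :=
  [/\ D 1, forall x y, D x -> D y -> D (x * y), forall x, D x -> D x^-1
    & forall x y, D x -> D (x ^ y)].

Section CommutatorIdentities.
Variable G : groupType.
Implicit Types x y z : G.

Let groupE := (commgEl, conjgE, @invgM G, @invgK G, @mulgA G, @mulgK G, @mulgVK G,
  @mulVg G, @mulgV G, @mul1g G, @mulg1 G).

Lemma commMgJ x y z : [~ x * y, z] = [~ x, z] ^ y * [~ y, z].
Proof. by rewrite !groupE. Qed.

Lemma commgMJ x y z : [~ x, y * z] = [~ x, z] * [~ x, y] ^ z.
Proof. by rewrite !groupE. Qed.

Lemma commVgJ x y : [~ x^-1, y] = ([~ x, y] ^ x^-1)^-1.
Proof. by rewrite !groupE. Qed.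

Lemma commgVJ x y : [~ x, y^-1] = ([~ x, y] ^ y^-1)^-1.
Proof. by rewrite !groupE. Qed.

End CommutatorIdentities.

Lemma normal_subgroup_commg (T : choiceType) (D : freegroup T -> Prop) :
  normal_subgroup D -> (forall s t, D [~ fgen s, fgen t]) ->
  forall x y, D [~ x, y].
Proof.
case=> D1 DM DV DJ Dgen.
have Dx s y : D [~ fgen s, y].
  elim/freegroup_ind: y => [|t y IH|t y IH]; rewrite ?commg1 // commgMJ.
    by apply: DM => //; apply: DJ.
  by apply: DM => //; rewrite commgVJ; apply/DJ/DV/DJ.
move=> x y; elim/freegroup_ind: x => [|s x IH|s x IH]; rewrite ?comm1g // commMgJ.
  by apply: DM => //; apply: DJ.
by apply: DM => //; rewrite commVgJ; apply/DJ/DV/DJ.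
Qed.

Notation gena := (fgen true : F2).
Notation genb := (fgen false : F2).
Notation comm_ab := [~ gena, genb].

Definition zpow (G : groupType) (x : G) (i : int) : G :=
  match i with Posz n => x ^+ n | Negz n => x ^- n.+1 end.

Lemma zpowS (G : groupType) (x : G) i : zpow x (1 + i)%R = x * zpow x i.
Proof.
case: i => [n|[|n]]; first by rewrite -[(1 + _)%R]/(Posz n.+1) /= expgS.
  by rewrite [(1 + _)%R](_ : _ = 0%R) //= expg1 mulgV.
rewrite [(1 + _)%R](_ : _ = Negz n) /=; last by rewrite !NegzE -[n.+2]addn1 PoszD; ring.
by rewrite [x ^+ n.+2]expgSr invgM mulVKg.
Qed.

Lemma zpowP (G : groupType) (x : G) i : zpow x (-1 + i)%R = x^-1 * zpow x i.
Proof.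
by rewrite -[in RHS](_ : 1 + (-1 + i) = i)%R; [rewrite zpowS mulKg | ring].
Qed.

Definition expo (s : bool) : F2 -> int :=
  fg_lift (fun t => Posz (t == s) : to_multiplicative int).

Lemma expoM s g h : expo s (g * h) = (expo s g + expo s h)%R.
Proof. exact: (@fg_liftM _ (to_multiplicative int)). Qed.

Lemma expo_gen s t : expo s (fgen t) = (if t == s then 1 else 0)%R.
Proof. by rewrite /expo fg_lift_gen; case: eqP. Qed.

Lemma expo1 s : expo s 1 = 0%R.
Proof. by []. Qed.

Lemma expoV s g : expo s g^-1 = (- expo s g)%R.
Proof. by apply/eqP; rewrite -addr_eq0 -expoM mulVg expo1. Qed.

Lemma expoX s g n : expo s (g ^+ n) = (expo s g *+ n)%R.
Proof. by elim: n => [|n IH] //; rewrite expgS expoM IH mulrS. Qed.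

Lemma additive_expo (V : zmodType) (f : F2 -> V) :
  (forall g h, f (g * h) = (f g + f h)%R) ->
  forall g, f g = (f gena *~ expo true g + f genb *~ expo false g)%R.
Proof.
move=> fM; have f1 : f 1 = 0%R by apply: (addrI (f 1)); rewrite -fM mulg1 addr0.
have fV g : f g^-1 = (- f g)%R by apply/eqP; rewrite -addr_eq0 -fM mulVg f1.
elim/freegroup_ind => [|s g IH|s g IH]; first by rewrite f1 !mulr0z addr0.
  rewrite fM !expoM !expo_gen IH.
  by case: s => /=; rewrite add0r mulrzDr mulr1z; [rewrite addrA | rewrite addrCA].
rewrite fM fV !expoM !expoV !expo_gen IH.
by case: s => /=; rewrite oppr0 add0r mulrzDr mulrNz mulr1z; [rewrite addrA | rewrite addrCA].
Qed.

(** Modulo a normal subgroup containing the commutators, a letter moves freely past a power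
   of [a]; so an element is determined by its exponent sums. *)
Lemma abelian_normal_form (D : F2 -> Prop) :
  normal_subgroup D -> (forall x y, D [~ x, y]) -> forall g,
  D ((zpow gena (expo true g) * zpow genb (expo false g))^-1 * g).
Proof.
move=> [D1 DM DV DJ] DC.
have DBx (u x y g : F2) : D ((x * y)^-1 * g) -> D ((x * (u * y))^-1 * (u * g)).
  move=> Dg; rewrite (_ : _ * _ = [~ u, x] ^ y * ((x * y)^-1 * g)).
    by apply: DM => //; apply: DJ.
  by rewrite !commgEl !conjgE !invgM !mulgA !mulgK.
elim/freegroup_ind => [|s g IH|s g IH]; first by rewrite /= !mulg1 invg1.
  rewrite !expoM !expo_gen; case: s => /=; rewrite add0r zpowS; last exact: DBx.
  by rewrite -mulgA invgM -mulgA mulKg.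
rewrite !expoM !expoV !expo_gen; case: s => /=; rewrite oppr0 add0r zpowP; last exact: DBx.
by rewrite -[_ * zpow gena _ * _]mulgA invgM -mulgA mulKg.
Qed.

(** * The scaling character of an archimedean class stable under conjugation *)

Section NormalClass.
Variables (G : groupType) (o : biorder G) (c : G).
Implicit Types g h x y : G.

Definition normal_arch : Prop := forall g, arch o c (c ^ g).

Definition bounded h : Prop := exists k, bole o (c ^- k) h /\ bole o h (c ^+ k).

Hypothesis cN : normal_arch.

Let c1 : bolt o 1 c. Proof. by have [] := cN 1. Qed.

Lemma bounded_normal : normal_subgroup bounded.
Proof.
split.
- by exists 0%N; rewrite expg0 invg1; split; exact: bolexx.
- move=> x y [k [kx xk]] [l [ly yl]]; exists (k + l)%N; split.
    by rewrite addnC expgnDr invgM; apply: boleM.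
  by rewrite expgnDr; apply: boleM.
- by move=> x [k [kx xk]]; exists k; split; [|rewrite -[c ^+ k]invgK]; apply: boleV.
- move=> x y [k [kx xk]]; have [_ _ _ [l yc]] := cN y; exists (l * k)%N.
  have cy : bole o (c ^+ k ^ y) (c ^+ (l * k)).
    by rewrite conjXg expgnA; apply: boleX.
  split.
    by apply: bole_trans (boleV cy) _; rewrite -conjVg; apply: bole_conj.
  exact: bole_trans (bole_conj _ xk) cy.
Qed.

Lemma power_interval x n : bolt o 1 x -> bolt o x (c ^+ n) ->
  exists j, bole o (c ^+ j) x /\ bolt o x (c ^+ j.+1).
Proof.
move=> x1; elim: n => [/(bolt_asym x1) //|n IH] xn.
by case: (boltP o x (c ^+ n)) => [/IH|nx] //; exists n.
Qed.

(** If [c ^+ j <= x < c ^+ j.+1], then conjugation by [x] moves [c] to less than [c ^+ 2]: an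
   element of the convex subgroup generated by [c] scales [c] by the factor [1].  So a positive
   element that at least doubles [c] lies beyond this subgroup. *)
Lemma bolt_unbounded x : bolt o 1 x -> bole o (c ^+ 2) (c ^ x) ->
  forall k, bolt o (c ^+ k) x.
Proof.
move=> x1 cx k; case: (boltP o (c ^+ k) x) => // xk.
have [|j [jx xj]] := @power_interval x k.+1 x1.
  by apply: bole_lt_trans xk _; rewrite expgSr -{1}[c ^+ k]mulg1; apply: boltM2l.
case: (bole_ngt cx); rewrite conjgE.
apply: bole_lt_trans (boleM2r _ (boleV jx)) _.
have := boltM2l (c ^- j) (boltM2l c xj).
by rewrite -expgS -[j.+2]addn2 expgnDr mulKg.
Qed.

Section Scale.
Variable R : realType.
Local Open Scope ring_scope.

Definition scale g : R := ratio o R c (c ^ g)%g.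

Lemma scale_gt0 g : 0 < scale g.
Proof. exact: ratio_gt0. Qed.

Lemma scaleM g h : scale (g * h)%g = scale g * scale h.
Proof.
rewrite /scale conjgM (ratioM _ (cN h) (arch_conj h (cN g))) ratio_conj.
exact: mulrC.
Qed.

Lemma scaleX g n : scale (g ^+ n)%g = scale g ^+ n.
Proof.
elim: n => [|n IH]; last by rewrite expgS scaleM IH exprS.
by rewrite expg0 /scale conjg1 ratioxx.
Qed.

(** By the chain rule [d ^ g : d] is [(d ^ g : c ^ g) (c ^ g : c) (c : d)], whose outer
   factors are inverse to each other since conjugation preserves ratios. *)
Lemma scale_base d g : arch o c d -> ratio o R d (d ^ g)%g = scale g.
Proof.
move=> cd; have dc := arch_sym cd; have cgdg := arch_conj g cd.
rewrite (ratioM _ dc (arch_trans (cN g) cgdg)) (ratioM _ (cN g) cgdg).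
by rewrite ratio_conj mulrCA [X in _ * X]mulrC (ratioC _ cd) mulr1.
Qed.

End Scale.
End NormalClass.

(** * An open set of bi-orders *)

Lemma nbhs_bolt (G : groupType) (o : biorder G) x y :
  bolt o x y -> nbhs o [set o' | bolt o' x y].
Proof.
move=> xy; apply/nbhs_biorder; exists [set (x^-1 * y)]; split.
- exact: finite_set1.
- by move=> _ ->; have /bolt_poscone := xy.
- by move=> o' h; apply/bolt_poscone; apply: h.
Qed.

(** In terms of [v = log2 (scale _)] and of the slope [beta] of the order on [Z^2]:
   [pinched_B] and [pinched_A] give [0 <= beta <= 1/4], [pinched_CA4] and [pinched_CA4V] give
   [|v a| <= 1/4], [pinched_CB] and [pinched_CB2] give [1 <= v b <= 3/2].  The fields
   [pinched_CA] and [pinched_CAV] serve to bound the conjugates of [c] by powers of [c]. *)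
Record pinched (o : biorder F2) : Prop := Pinched {
  pinched_C : bolt o 1 comm_ab ;
  pinched_B : bolt o 1 genb ;
  pinched_A : bolt o (genb ^+ 4) gena ;
  pinched_CA : bolt o (comm_ab ^ gena) (comm_ab ^+ 2) ;
  pinched_CAV : bolt o (comm_ab ^ gena^-1) (comm_ab ^+ 2) ;
  pinched_CA4 : bolt o (comm_ab ^ (gena ^+ 4)) (comm_ab ^+ 2) ;
  pinched_CA4V : bolt o (comm_ab ^ (gena ^- 4)) (comm_ab ^+ 2) ;
  pinched_CB : bolt o (comm_ab ^+ 2) (comm_ab ^ genb) ;
  pinched_CB2 : bolt o (comm_ab ^ (genb ^+ 2)) (comm_ab ^+ 8) }.

Lemma nbhs_pinched o : pinched o -> nbhs o pinched.
Proof.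
case=> /nbhs_bolt h1 /nbhs_bolt h2 /nbhs_bolt h3 /nbhs_bolt h4 /nbhs_bolt h5.
move=> /nbhs_bolt h6 /nbhs_bolt h7 /nbhs_bolt h8 /nbhs_bolt h9.
near=> o'; split; near: o'; assumption.
Unshelve. all: by end_near.
Qed.

Section Pinched.
Variables (o : biorder F2).
Hypothesis po : pinched o.

(** If conjugation by each letter maps [c] below [c ^+ 8], then conjugation by a word of length
   [n] maps it below [c ^+ (8 ^ n)]; conjugating back gives the bound from below. *)
Lemma pinched_arch : normal_arch o comm_ab.
Proof.
have [C1 B1 _ CA CAV _ _ CB CB2] := po.
(* The bounds on the conjugates by [b] and by its inverse come from the chain
   [c < c ^+ 2 < c ^ b < c ^ (b ^+ 2) < c ^+ 8]. *)
have C2 : bolt o comm_ab (comm_ab ^+ 2).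
  by rewrite expg2 -{1}[comm_ab]mulg1; apply: boltM2l.
have CltCB : bolt o comm_ab (comm_ab ^ genb) := bolt_trans C2 CB.
have CBV : bolt o (comm_ab ^ genb^-1) comm_ab.
  by rewrite -{2}[comm_ab](conjgK genb); apply: bolt_conj.
have CB8 : bolt o (comm_ab ^ genb) (comm_ab ^+ 8).
  apply: bolt_trans CB2; rewrite expg2 conjgM; exact: bolt_conj.
have le8 x k : k <= 8 -> bolt o x (comm_ab ^+ k) -> bole o x (comm_ab ^+ 8).
  by move=> k8 /boltW xk; apply: bole_trans xk (bole_wX2l _ k8); apply: boltW.
have le8_gen s : bole o (comm_ab ^ (fgen s : F2)) (comm_ab ^+ 8) /\
    bole o (comm_ab ^ (fgen s : F2)^-1) (comm_ab ^+ 8).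
  case: s; split; first [exact: le8 2 _ CA | exact: le8 2 _ CAV
    | exact: le8 8 _ CB8 | exact: le8 1%N _ CBV].
have bnd g : exists k, bole o (comm_ab ^ g) (comm_ab ^+ k).
  have step (x h : F2) : bole o (comm_ab ^ x) (comm_ab ^+ 8) ->
      (exists k, bole o (comm_ab ^ h) (comm_ab ^+ k)) ->
      exists k, bole o (comm_ab ^ (x * h)) (comm_ab ^+ k).
    move=> x8 [k hk]; exists (k * 8)%N; rewrite conjgM.
    apply: bole_trans (bole_conj _ x8) _; rewrite conjXg expgnA; exact: boleX.
  elim/freegroup_ind: g => [|s g IH|s g IH].
  - by exists 1%N; rewrite conjg1; exact: bolexx.
  - by apply: step IH; case: (le8_gen s).
  - by apply: step IH; case: (le8_gen s).
move=> g; split=> //; first by rewrite -(conj1g g); apply: bolt_conj.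
  have [k /(bole_conj g)] := bnd g^-1; rewrite conjgKV conjXg; by exists k.
Qed.

Lemma pinched_commg x y : bounded o comm_ab [~ x, y].
Proof.
have N := bounded_normal pinched_arch; have [N1 _ NV _] := N.
have NC : bounded o comm_ab comm_ab.
  exists 1%N; split; last exact: bolexx.
  apply: boltW; apply: bolt_trans (pinched_C po).
  by rewrite -invg1; apply/boltV/(pinched_C po).
apply: (normal_subgroup_commg N) => -[] []; rewrite ?commgg //.
by rewrite -[X in bounded _ _ X]invgR; apply: NV.
Qed.

Lemma pinched_ltB k : bolt o (comm_ab ^+ k) genb.
Proof.
by case: po => *; apply: (bolt_unbounded pinched_arch) => //; apply: boltW.
Qed.

Lemma pinched_ltA k : bolt o (comm_ab ^+ k) gena.
Proof.
case: po => _ B1 BA *; apply: bolt_trans BA; apply: bolt_le_trans (pinched_ltB k) _.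
by rewrite -{1}[genb]expg1; apply: bole_wX2l => //; apply: boltW.
Qed.

(** Such a [g] is a power of [a] times an element bounded by powers of [c], and [a] exceeds
   all powers of [c]; so the sign of the exponent of [a] decides. *)
Lemma pinched_expo g : bolt o 1 g -> expo false g = 0%R -> (0 <= expo true g)%R.
Proof.
move=> g1 eg.
have := abelian_normal_form (bounded_normal pinched_arch) pinched_commg g.
rewrite eg /= mulg1; case: (expo true g) => //= n [k [_]]; rewrite invgK => gk.
have A1 : bolt o 1 gena := pinched_ltA 0.
have : bolt o (gena ^+ n.+1 * g) gena := bole_lt_trans gk (pinched_ltA k).
case/bole_ngt; apply: bole_trans (_ : bole o gena (gena ^+ n.+1)) _.
  by rewrite -{1}[gena]expg1; apply: bole_wX2l => //; apply: boltW.
by rewrite -{1}[gena ^+ _]mulg1; apply: boleM2l; apply: boltW.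
Qed.

Section Slope.
Variable R : realType.
Local Open Scope ring_scope.

(** The exponent sums of positive elements form an additive semigroup of [Z^2] meeting the line
   of multiples of [a] in nonnegative multiples only ([pinched_expo]), hence lie in a
   half-plane.  Its slope is the supremum of the ratios [m / n] such that some positive element
   has exponent sums [(- m, n)] with [n > 0]. *)
Lemma pinched_slope : exists beta : R, [/\ 0 <= beta, 4 * beta <= 1 &
  forall g, bolt o 1%g g -> 0 <= (expo true g)%:~R + beta * (expo false g)%:~R].
Proof.
pose E := [set r : R | exists g (n : nat), [/\ bolt o 1%g g,
  expo false g = n.+1%:Z & r = - (expo true g)%:~R / n.+1%:R]].
have BE : E 0.
  exists genb, 0%N; split; [exact: pinched_B po | by rewrite expo_gen |].
  by rewrite expo_gen /= oppr0 mul0r.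
have below g m : bolt o 1%g g -> expo false g = - m.+1%:Z ->
    ubound E ((expo true g)%:~R / m.+1%:R).
  move=> g1 em _ [h [n [h1 en ->]]].
  have := @pinched_expo (g ^+ n.+1 * h ^+ m.+1)%g.
  rewrite !expoM !expoX em en.
  have gh := boltM (boltX (ltn0Sn n) g1) (boltX (ltn0Sn m) h1).
  rewrite !expg1n mulg1 in gh.
  have -> : - m.+1%:Z *+ n.+1 + n.+1%:Z *+ m.+1 = 0.
    by rewrite mulNrn -mulr_natr -[X in _ + X]mulr_natr !natz mulrC addNr.
  move=> /(_ gh erefl).
  rewrite ler_pdivrMr ?ltr0n // mulrAC ler_pdivlMr ?ltr0n //.
  by rewrite -(ler_int R) rmorphD /= !rmorphMn /= -mulr_natr -[X in _ + X]mulr_natr; lra.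
have E0 : E !=set0 by exists 0.
have BA : bolt o 1%g (genb ^- 4 * gena)%g by have /bolt_poscone := pinched_A po.
have eBA : expo false (genb ^- 4 * gena)%g = - 4%:Z.
  by rewrite expoM expoV expoX !expo_gen.
have eBA' : expo true (genb ^- 4 * gena)%g = 1.
  by rewrite expoM expoV expoX !expo_gen.
have ub := below _ _ BA eBA; rewrite eBA' in ub.
have Eub : has_ubound E by exists (1%:~R / 4%:R).
exists (sup E); split.
- exact: ub_le_sup.
- by rewrite mulrC -ler_pdivlMr ?ltr0n //; apply: ge_sup.
move=> g g1; case e : (expo false g) => [[|n]|m].
- by rewrite mulr0 addr0 ler0z; apply: pinched_expo.
- have : - (expo true g)%:~R / n.+1%:R <= sup E.
    by apply: ub_le_sup => //; exists g, n.
  by rewrite ler_pdivrMr ?ltr0n //= -pmulrn; lra.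
have : sup E <= (expo true g)%:~R / m.+1%:R by apply: ge_sup => //; apply: below.
by rewrite ler_pdivlMr ?ltr0n // NegzE mulrNz /= -pmulrn; lra.
Qed.

Definition logscale g : R := ln (scale o comm_ab R g) / ln 2.

Lemma logscaleM g h : logscale (g * h)%g = logscale g + logscale h.
Proof.
have N := pinched_arch.
by rewrite /logscale (scaleM N) lnM ?mulrDl // posrE; apply: scale_gt0.
Qed.

Lemma logscale_le g m n : bole o (comm_ab ^ (g ^+ n))%g (comm_ab ^+ (2 ^ m))%g ->
  n%:R * logscale g <= m%:R.
Proof.
have N := pinched_arch => gm.
have l2 : 0 < ln (2 : R) by apply: ln_gt0; lra.
have := @ratio_ge _ o R _ _ (2 ^ m)%N 1%N (N (g ^+ n)%g) gm; rewrite mul1r.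
rewrite -/(scale o comm_ab R _) (scaleX N).
rewrite -ler_ln ?posrE ?exprn_gt0 ?(scale_gt0 N) ?ltr0n ?expn_gt0 //.
rewrite natrX !lnXn ?(scale_gt0 N) ?ltr0n //.
by rewrite /logscale mulrA ler_pdivrMr // !mulr_natl.
Qed.

Lemma logscale_ge g m n : bole o (comm_ab ^+ (2 ^ m))%g (comm_ab ^ (g ^+ n))%g ->
  m%:R <= n%:R * logscale g.
Proof.
have N := pinched_arch => gm.
have l2 : 0 < ln (2 : R) by apply: ln_gt0; lra.
have := @ratio_le _ o R _ _ (2 ^ m)%N 1%N (N (g ^+ n)%g) gm; rewrite mul1r.
rewrite -/(scale o comm_ab R _) (scaleX N).
rewrite -ler_ln ?posrE ?exprn_gt0 ?(scale_gt0 N) ?ltr0n ?expn_gt0 //.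
rewrite natrX !lnXn ?(scale_gt0 N) ?ltr0n //.
by rewrite /logscale mulrA ler_pdivlMr // !mulr_natl.
Qed.

End Slope.
End Pinched.

(** * Rigidity *)

Lemma int_eq0 (R : realDomainType) (n : int) :
  (-1 < n%:~R :> R)%R -> (n%:~R < 1 :> R)%R -> n = 0%R.
Proof.
move=> h1 h2; have {}h1 : (-1 < n)%R by rewrite -(ltr_int R) rmorphN.
have {}h2 : (n < 1)%R by rewrite -(ltr_int R).
by case: n h1 h2 => [[|n]|n].
Qed.

(** Here [(x, V)] and [(x', V')] are the values of the linear form [v] on the generators, for
   two orders related by the matrix with columns [(p, r)] and [(q, u)], and [W], [Z] are the
   values of [w] on these columns.  The determinant of two linear forms scales with that of
   the matrix: [V' W - x' Z = det * (V - beta x)].  Both sides are close to known positive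
   multiples of [1] and [W], so [det = 1] and [W] lies between [3/5] and [5/3].  As [x] and
   [x'] are small, [r] is then less than [1] in absolute value, so [r = 0] and [p = W = 1],
   and the bound on [Z] leaves only [q = 0]. *)
Lemma matrix_eq1 (R : realFieldType) (p q r u : int) (x V x' V' be : R) :
  let W : R := (p%:~R + be * r%:~R)%R in
  let Z : R := (q%:~R + be * u%:~R)%R in
  (-1 <= 4 * x <= 1 -> 2 <= 2 * V <= 3 -> -1 <= 4 * x' <= 1 -> 2 <= 2 * V' <= 3 ->
  0 <= be -> 4 * be <= 1 -> 0 <= Z -> 4 * Z <= W ->
  x' = x * p%:~R + V * r%:~R -> V' = x * q%:~R + V * u%:~R ->
  p * u - q * r = 1 \/ p * u - q * r = -1 ->
  [/\ p = 1, q = 0, r = 0 & u = 1])%R.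
Proof.
move=> W Z /andP[x1 x2] /andP[V1 V2] /andP[x1' x2'] /andP[V1' V2'] be0 be1 Z0 ZW.
move=> ex' eV' det.
have D1 : (15/16 <= V - be * x)%R by nra.
have D2 : (V - be * x <= 25/16)%R by nra.
have key : (V' * W - x' * Z = (p * u - q * r)%:~R * (V - be * x))%R.
  by rewrite ex' eV' /W /Z rmorphB !rmorphM /=; ring.
have key2 : (r%:~R * (V - be * x) = x' - W * x)%R by rewrite ex' /W; ring.
have W0 : (0 <= W)%R by lra.
have L1 : (15/16 * W <= V' * W - x' * Z)%R by nra.
have L2 : (V' * W - x' * Z <= 25/16 * W)%R by nra.
have det1 : (p * u - q * r = 1)%R.
  case: det => // e; move: key; rewrite e mulrN1z mulN1r => key; exfalso; lra.
rewrite det1 mul1r in key.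
have W1 : (3/5 <= W)%R by lra.
have W2 : (W <= 5/3)%R by lra.
have Wx1 : (x' - W * x <= 2/3)%R by nra.
have Wx2 : (-(2/3) <= x' - W * x)%R by nra.
have r0 : r = 0%R.
  by apply: (@int_eq0 R); rewrite ltNge; apply/negP => ?; nra.
have p1 : p = 1%R.
  apply/eqP; rewrite -subr_eq0; apply/eqP/(@int_eq0 R);
    rewrite rmorphB /=; move: W1 W2; rewrite /W r0 mulr0 addr0; lra.
have u1 : u = 1%R by move: det1; rewrite p1 r0 mul1r mulr0 subr0.
have q0 : q = 0%R.
  by apply: (@int_eq0 R); move: Z0 ZW W2; rewrite {1 2}/Z u1 mulr1; lra.
by split.
Qed.

Section Rigidity.
Variables (o1 o2 : biorder F2) (tau theta : {multiplicative F2 -> F2}).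
Hypotheses (po1 : pinched o1) (po2 : pinched o2).
Hypotheses (tauK : cancel tau theta) (thetaK : cancel theta tau).
Hypothesis tauP : forall x y, bolt o2 x y <-> bolt o1 (tau x) (tau y).

Let tau_le x y : bole o2 x y <-> bole o1 (tau x) (tau y).
Proof.
split=> -[e|/tauP]; try by right.
  by left; rewrite e.
by left; apply: (can_inj tauK).
Qed.

Let tauX x n : tau (x ^+ n) = tau x ^+ n.
Proof. by elim: n => [|n IH]; rewrite ?mulmorph1 // !expgS gmulfM IH. Qed.

Let tauJ x g : tau (x ^ g) = tau x ^ tau g.
Proof. by rewrite !conjgE !gmulfM mulmorphV. Qed.

Let C1 : bolt o1 1 (tau comm_ab).
Proof. by rewrite -(mulmorph1 tau); apply/tauP/(pinched_C po2). Qed.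

Lemma commg_morph (f : {multiplicative F2 -> F2}) (x y : F2) : f [~ x, y] = [~ f x, f y].
Proof. by rewrite !commgEl !conjgE !gmulfM !mulmorphV. Qed.

(** The image of the commutator [c] is a commutator, so it is bounded by a power of [c]; the
   same argument for the inverse automorphism gives the bound from below. *)
Lemma arch_tau : arch o1 comm_ab (tau comm_ab).
Proof.
split=> //; first exact: pinched_C po1.
  have := pinched_commg po2 (theta gena) (theta genb); rewrite -commg_morph.
  by case=> k [_ /tau_le]; rewrite thetaK tauX; exists k.
have := pinched_commg po1 (tau gena) (tau genb); rewrite -commg_morph.
by case=> k [_ ?]; exists k.
Qed.

Variable R : realType.
Local Open Scope ring_scope.

Lemma scale_tau g : scale o2 comm_ab R g = scale o1 comm_ab R (tau g).
Proof.
rewrite -(scale_base (pinched_arch po1) _ _ arch_tau) /scale -tauJ.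
congr sup; apply/seteqP; split=> r [k [n [n0 xy ->]]]; exists k, n; split=> //.
  by rewrite -!tauX; apply/tau_le.
by apply/tau_le; rewrite !tauX.
Qed.

Lemma logscale_tau g : logscale o2 R g = logscale o1 R (tau g).
Proof. by rewrite /logscale scale_tau. Qed.

Let expo_tau s g :
  expo s (tau g) = expo s (tau gena) * expo true g + expo s (tau genb) * expo false g.
Proof.
rewrite (additive_expo (f := fun h => expo s (tau h))) ?mulrzz //.
by move=> h h'; rewrite gmulfM expoM.
Qed.

Let expo_theta s g :
  expo s (theta g) = expo s (theta gena) * expo true g + expo s (theta genb) * expo false g.
Proof.
rewrite (additive_expo (f := fun h => expo s (theta h))) ?mulrzz //.
by move=> h h'; rewrite gmulfM expoM.
Qed.

Let det_tau :
  let d := expo true (tau gena) * expo false (tau genb) -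
           expo true (tau genb) * expo false (tau gena) in d = 1 \/ d = -1.
Proof.
move=> d.
pose d' := expo true (theta gena) * expo false (theta genb) -
           expo true (theta genb) * expo false (theta gena).
pose L s t := expo s (tau gena) * expo true (theta (fgen t)) +
    expo s (tau genb) * expo false (theta (fgen t)).
have LE s t : L s t = if t == s then 1 else 0.
  by rewrite /L -expo_tau thetaK expo_gen.
have dd : d * d' = 1.
  have -> : d * d' = L true true * L false false - L true false * L false true.
    by rewrite /d /d' /L; ring.
  by rewrite !LE /= mulr1 mulr0 subr0.
have : (`|d| * `|d'| = 1)%N by rewrite -abszM dd.
move/eqP; rewrite muln_eq1 => /andP[/eqP d1 _].
by case: (d) d1 => n; [left; congr Posz | case: n => // _; right].
Qed.

(** The [v] of the second order is the [v] of the first composed with [tau], and [tau] acts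
   trivially on [Z^2] by [matrix_eq1]. *)
Lemma pinched_rigid : scale o1 comm_ab R genb = scale o2 comm_ab R genb.
Proof.
have [be [be0 be1 slope]] := pinched_slope po1 R.
have bounds o (po : pinched o) : -1 <= 4 * logscale o R gena <= 1 /\
    2 <= 2 * logscale o R genb <= 3.
  have [_ _ _ _ _ CA4 CA4V CB CB2] := po.
  have h1 := logscale_le po R (m := 1) (boltW CA4).
  have h2 : 4%:R * logscale o R gena^-1%g <= 1%:R.
    by apply: (logscale_le po); rewrite expVgn; apply: boltW.
  have h3 := logscale_ge po R (m := 1) (n := 1) (boltW CB).
  have h4 := logscale_le po R (m := 3) (boltW CB2).
  have h5 : logscale o R gena^-1%g = - logscale o R gena.
    apply/eqP; rewrite -addr_eq0 -(logscaleM po) mulVg /logscale.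
    by rewrite /scale conjg1 ratioxx ?ln1 ?mul0r //; exact: pinched_C.
  by split; lra.
have [[bA bB] [bA' bB']] := (bounds _ po1, bounds _ po2).
have lin g : logscale o1 R g =
    logscale o1 R gena * (expo true g)%:~R + logscale o1 R genb * (expo false g)%:~R.
  by rewrite !mulrzr; apply: (additive_expo (@logscaleM _ po1 R)).
have Z0 : 0 <= (expo true (tau genb))%:~R + be * (expo false (tau genb))%:~R.
  by apply: slope; rewrite -(mulmorph1 tau); apply/tauP/(pinched_B po2).
have ZW : 4 * ((expo true (tau genb))%:~R + be * (expo false (tau genb))%:~R) <=
    (expo true (tau gena))%:~R + be * (expo false (tau gena))%:~R.
  have /slope : bolt o1 1%g (tau (genb ^- 4 * gena)%g).
    have /bolt_poscone h := pinched_A po2.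
    by rewrite -(mulmorph1 tau); apply/tauP.
  rewrite !(expo_tau _ (genb ^- 4 * gena)%g) !expoM !expoV !expoX !expo_gen /=.
  by rewrite !(rmorphD, rmorphM, rmorphN, rmorphMn) /=; lra.
have [] := matrix_eq1 bA bB bA' bB' be0 be1 Z0 ZW _ _ det_tau.
- by rewrite logscale_tau lin.
- by rewrite logscale_tau lin.
move=> _ q0 _ u1.
have l2 : ln (2 : R) != 0 by rewrite gt_eqF // ln_gt0; lra.
have : logscale o2 R genb = logscale o1 R genb.
  by rewrite logscale_tau lin q0 u1 mulr0 mulr1 add0r.
move=> /(divIf l2) /esym /ln_inj; apply; rewrite posrE; apply: scale_gt0;
  exact: pinched_arch.
Qed.

End Rigidity.

(** * Bi-orders with a prescribed scale *)

Record positive_cone (G : groupType) (P : G -> Prop) : Prop := PositiveCone {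
  cone1 : ~ P 1 ;
  coneM : forall x y, P x -> P y -> P (x * y) ;
  coneJ : forall x y, P x -> P (x ^ y) ;
  cone_total : forall x, [\/ x = 1, P x | P x^-1] }.

Section BiOrderOfCone.
Variables (G : groupType) (P : G -> Prop).
Hypothesis PC : positive_cone P.

Let lt x y := P (x^-1 * y).

Fact cone_irr x : ~ lt x x.
Proof. by rewrite /lt mulVg; exact: cone1 PC. Qed.

Fact cone_trans y x z : lt x y -> lt y z -> lt x z.
Proof. by rewrite /lt => xy yz; have := coneM PC xy yz; rewrite mulgA mulgK. Qed.

Fact cone_lt_total x y : [\/ x = y, lt x y | lt y x].
Proof.
have := cone_total PC (x^-1 * y); rewrite invgM invgK => -[e|h|h].
- by constructor 1; rewrite -[y](mulVKg x) e mulg1.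
- by constructor 2.
- by constructor 3.
Qed.

Fact cone_ltM2l z x y : lt x y -> lt (z * x) (z * y).
Proof. by rewrite /lt invgM -mulgA mulKg. Qed.

Fact cone_ltM2r z x y : lt x y -> lt (x * z) (y * z).
Proof. by rewrite /lt => /(coneJ PC z); rewrite conjgE invgM !mulgA. Qed.

Definition biorder_of_cone : biorder G :=
  BiOrder cone_irr cone_trans cone_lt_total cone_ltM2l cone_ltM2r.

Lemma biorder_of_coneE x : bolt biorder_of_cone 1 x <-> P x.
Proof. by rewrite /= /lt invg1 mul1g. Qed.

End BiOrderOfCone.

Section Lexicographic.
Variables (G H : groupType) (f : {multiplicative G -> H}).
Variables (oH : biorder H) (oG : biorder G).

Definition lex_cone x : Prop := bolt oH 1 (f x) \/ f x = 1 /\ bolt oG 1 x.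

Lemma lex_cone_positive : positive_cone lex_cone.
Proof.
split.
- by case=> [|[_]]; rewrite ?mulmorph1; apply: bolt_irr.
- move=> x y [fx|[fx x1]] [fy|[fy y1]]; rewrite /lex_cone gmulfM.
  + by left; rewrite -[1]mulg1; apply: boltM.
  + by left; rewrite fy mulg1.
  + by left; rewrite fx mul1g.
  + by right; rewrite fx fy mulg1; split=> //; rewrite -[1]mulg1; apply: boltM.
- move=> x y; rewrite /lex_cone conjgE !gmulfM mulmorphV -!conjgE.
  case=> [fx|[-> x1]]; first by left; rewrite -(conj1g (f y)); apply: bolt_conj.
  by right; rewrite conj1g; split=> //; rewrite -(conj1g y); apply: bolt_conj.
move=> x; rewrite /lex_cone mulmorphV.
case: (bolt_total oH 1 (f x)) => [<-|fx|fx].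
- case: (bolt_total oG 1 x) => [<-|x1|x1]; first by constructor 1.
    by constructor 2; right.
  by constructor 3; right; rewrite invg1; split=> //; rewrite -invg1; apply: boltV.
- by constructor 2; left.
- by constructor 3; left; rewrite -invg1; apply: boltV.
Qed.

Definition lex_biorder : biorder G := biorder_of_cone lex_cone_positive.

Lemma lex_bolt_base x y : bolt oH (f x) (f y) -> bolt lex_biorder x y.
Proof.
move=> /bolt_poscone xy; apply/bolt_poscone/biorder_of_coneE.
by left; rewrite gmulfM mulmorphV.
Qed.

Lemma lex_bolt_fiber x y : f x = f y -> bolt oG x y -> bolt lex_biorder x y.
Proof.
move=> fxy /bolt_poscone xy; apply/bolt_poscone/biorder_of_coneE.
by right; rewrite gmulfM mulmorphV fxy mulVg.
Qed.

End Lexicographic.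

Section IntegerOrder.
Local Open Scope ring_scope.

Lemma int_cone_positive :
  @positive_cone (to_multiplicative int) (fun i => (0 : int) < i).
Proof.
split.
- by rewrite ltxx.
- exact: addr_gt0.
- by move=> x y; rewrite (_ : (x ^ y)%g = x) //; apply/conjg_fixP/commgP/commuteT.
move=> x; rewrite [(_^-1)%g]/(- _) oppr_gt0.
case: (ltgtP (0 : int) x) => [h|h|h]; first by constructor 2.
  by constructor 3.
by constructor 1.
Qed.

Definition int_order : biorder (to_multiplicative int) :=
  biorder_of_cone int_cone_positive.

End IntegerOrder.

Section Affine.
Variable R : realFieldType.
Local Open Scope ring_scope.

(** The pair [(s, d)] stands for the map [x |-> s x + d] acting on the right: in a product,
   the left factor is applied first. *)
Record affine := Affine { coef : R * R ; _ : 0 < coef.1 }.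
HB.instance Definition _ := [isSub for coef].
HB.instance Definition _ := [Choice of affine by <:].

Lemma slope_gt0 (x : affine) : 0 < (coef x).1.
Proof. exact: valP x. Qed.

Fact aff_one_subproof : 0 < (1, 0 : R).1 :> R. Proof. exact: ltr01. Qed.
Definition aff_one := Affine aff_one_subproof.

Fact aff_mul_subproof (x y : affine) :
  0 < ((coef x).1 * (coef y).1, (coef x).2 * (coef y).1 + (coef y).2).1.
Proof. by rewrite mulr_gt0 ?slope_gt0. Qed.
Definition aff_mul x y := Affine (aff_mul_subproof x y).

Fact aff_inv_subproof (x : affine) :
  0 < ((coef x).1^-1, - (coef x).2 / (coef x).1).1.
Proof. by rewrite invr_gt0 slope_gt0. Qed.
Definition aff_inv x := Affine (aff_inv_subproof x).

Fact aff_mulA : associative aff_mul.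
Proof. by move=> x y z; apply/val_inj; congr pair => /=; ring. Qed.
Fact aff_mul1 : left_id aff_one aff_mul.
Proof. by move=> x; apply/val_inj; case: x => -[s t] st; congr pair => /=; ring. Qed.
Fact aff_mulr1 : right_id aff_one aff_mul.
Proof. by move=> x; apply/val_inj; case: x => -[s t] st; congr pair => /=; ring. Qed.
Fact aff_mulV : left_inverse aff_one aff_inv aff_mul.
Proof.
move=> x; have := lt0r_neq0 (slope_gt0 x); case: x => -[s t] st /= s0.
by apply/val_inj; congr pair => /=; field.
Qed.
Fact aff_mulrV : right_inverse aff_one aff_inv aff_mul.
Proof.
move=> x; have := lt0r_neq0 (slope_gt0 x); case: x => -[s t] st /= s0.
by apply/val_inj; congr pair => /=; field.
Qed.
HB.instance Definition _ :=
  isGroup.Build affine aff_mulA aff_mul1 aff_mulr1 aff_mulV aff_mulrV.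

Definition aff_cone (x : affine) : Prop :=
  1 < (coef x).1 \/ (coef x).1 = 1 /\ 0 < (coef x).2.

Lemma aff_cone_positive : positive_cone aff_cone.
Proof.
split.
- by case=> [|[_]] /=; rewrite ltxx.
- move=> x y; have := slope_gt0 x; have := slope_gt0 y; rewrite /aff_cone /=.
  move=> sy sx [hx|[ex hx]] [hy|[ey hy]].
  + by left; nra.
  + by left; rewrite ey mulr1.
  + by left; rewrite ex mul1r.
  + by right; rewrite ex ey mulr1; split=> //; lra.
- move=> x y; have sy := slope_gt0 y; have y0 := lt0r_neq0 sy.
  rewrite /aff_cone conjgE /= mulrCA mulVf // mulr1 => -[hx|[ex hx]]; first by left.
  right; rewrite ex; split=> //.
  by rewrite mul1r mulfVK // addrCA addNr addr0 mulr_gt0.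
move=> x; have sx := slope_gt0 x; rewrite /aff_cone /=.
case: (ltgtP (coef x).1 1) => [s1|s1|s1].
- by constructor 3; left; rewrite invf_gt1.
- by constructor 2; left.
case: (ltgtP (coef x).2 0) => [t0|t0|t0].
- by constructor 3; right; rewrite s1 invr1 mulr1 oppr_gt0.
- by constructor 2; right.
- by constructor 1; apply/val_inj; case: x s1 t0 {sx} => -[s t] st /= -> ->.
Qed.

Definition aff_order : biorder affine := biorder_of_cone aff_cone_positive.

End Affine.

HB.instance Definition _ (s : bool) :=
  isMultiplicative.Build F2 (to_multiplicative int) (expo s) (expoM s).

Section Family.
Variable R : realType.
Local Open Scope ring_scope.

Definition dilation (t : R) (t0 : 0 < t) : affine R := @Affine R (t, 0) t0.
Definition translation (d : R) : affine R := @Affine R (1, d) ltr01.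

Lemma translationJ d (x : affine R) :
  (translation d ^ x)%g = translation (d * (coef x).1).
Proof.
have x0 := lt0r_neq0 (slope_gt0 x); apply/val_inj.
by rewrite conjgE /=; congr pair; rewrite mul1r ?mulVf // mulfVK // addrCA addNr addr0.
Qed.

Lemma bolt_translation d d' : d < d' ->
  bolt (aff_order R) (translation d) (translation d').
Proof.
move=> dd'; right; rewrite /= invr1 !mulr1; split=> //.
by rewrite addrC subr_gt0.
Qed.

Variables (o0 : biorder F2) (t : R) (t0 : 0 < t).

Definition affine_rep : F2 -> affine R :=
  fg_lift (fun s : bool => if s then translation 1 else dilation t0).
HB.instance Definition _ := Multiplicative.on affine_rep.

Lemma affine_rep_gen s :
  affine_rep (fgen s) = if s then translation 1 else dilation t0.
Proof. exact: fg_lift_gen. Qed.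

Lemma affine_repM x y : affine_rep (x * y)%g = (affine_rep x * affine_rep y)%g.
Proof. exact: gmulfM. Qed.

Lemma affine_repJ x y : affine_rep (x ^ y)%g = (affine_rep x ^ affine_rep y)%g.
Proof. by rewrite !conjgE !affine_repM mulmorphV. Qed.

(** Comparing exponent sums of [a] first makes [a] larger than all powers of [b]: the linear
   forms [v], proportional to the exponent sum of [b], and [w], that of [a], have to be
   independent. *)
Definition lex_affine : biorder F2 :=
  lex_biorder (expo true) int_order (lex_biorder affine_rep (aff_order R) o0).

Let slope x := (coef (affine_rep x)).1.

Let slopeM x y : slope (x * y)%g = slope x * slope y.
Proof. by rewrite /slope gmulfM. Qed.

Let slopeV x : slope (x^-1)%g = (slope x)^-1.
Proof. by rewrite /slope mulmorphV. Qed.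

Let slopeA : slope gena = 1.
Proof. by rewrite /slope affine_rep_gen. Qed.

Let slopeB : slope genb = t.
Proof. by rewrite /slope affine_rep_gen. Qed.

Lemma affine_repC : affine_rep comm_ab = translation (t - 1).
Proof.
rewrite commgEl conjgE !gmulfM !mulmorphV /= !affine_rep_gen.
have tn := lt0r_neq0 t0.
by apply/val_inj; congr pair => /=; field.
Qed.

Hypothesis t1 : 1 < t.

(** Conjugates of [c] have exponent sums [0] and act as translations, which conjugation by [x]
   rescales by the slope of [x]. *)
Lemma lex_affine_lt x y m n : m%:R * slope x < n%:R * slope y ->
  bolt lex_affine ((comm_ab ^ x) ^+ m)%g ((comm_ab ^ y) ^+ n)%g.
Proof.
move=> xy.
have e z k : expo true ((comm_ab ^ z) ^+ k)%g = 0.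
  rewrite expoX [comm_ab]commgEl !conjgE !expoM !expoV; ring.
have E z k : affine_rep ((comm_ab ^ z) ^+ k)%g = translation ((t - 1) * slope z * k%:R).
  elim: k => [|k IH].
    by rewrite mulmorph1; apply/val_inj; rewrite /= mulr0.
  rewrite expgS affine_repM IH affine_repJ affine_repC translationJ.
  by apply/val_inj; congr pair; rewrite /= ?mulr1 // -natr1; ring.
apply: lex_bolt_fiber; first exact: etrans (e x m) (esym (e y n)).
apply: lex_bolt_base.
have := @bolt_translation ((t - 1) * slope x * m%:R) ((t - 1) * slope y * n%:R).
rewrite -!E; apply.
by rewrite -!mulrA ltr_pM2l ?subr_gt0 // mulrC [X in _ < X]mulrC.
Qed.

Hypothesis t_itv : 2 < t < 5/2.

Lemma lex_affine_pinched : pinched lex_affine.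
Proof.
have [t2 t3] := andP t_itv.
have s1 : slope 1%g = 1 by rewrite /slope mulmorph1.
split.
- by have := @lex_affine_lt 1%g 1%g 0 1; rewrite conjg1; apply; rewrite s1; lra.
- apply: lex_bolt_fiber; first exact: esym (expo_gen true false).
  apply: lex_bolt_base; rewrite mulmorph1 /= affine_rep_gen.
  by left; rewrite /= invr1 mul1r.
- apply: lex_bolt_base.
  change (is_true (0 < - expo true (genb ^+ 4)%g + expo true gena)).
  by rewrite expoX !expo_gen.
- have := @lex_affine_lt gena 1%g 1 2; rewrite conjg1; apply; rewrite slopeA s1; lra.
- have := @lex_affine_lt (gena^-1)%g 1%g 1 2; rewrite conjg1; apply.
  rewrite slopeV slopeA s1; lra.
- have := @lex_affine_lt (gena ^+ 4)%g 1%g 1 2; rewrite conjg1; apply.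
  rewrite !expgS !slopeM slopeA s1; lra.
- have := @lex_affine_lt (gena ^- 4)%g 1%g 1 2; rewrite conjg1; apply.
  rewrite slopeV !expgS !slopeM slopeA s1; lra.
- have := @lex_affine_lt 1%g genb 2 1; rewrite conjg1; apply; rewrite slopeB s1; lra.
- have := @lex_affine_lt (genb ^+ 2)%g 1%g 1 8; rewrite conjg1; apply.
  rewrite expg2 slopeM slopeB s1; nra.
Qed.

Lemma lex_affine_scale : scale lex_affine comm_ab R genb = t.
Proof.
have pf := lex_affine_pinched; have CB := pinched_arch pf genb.
have [C1 CB1 _ _] := CB.
have s1 : slope 1%g = 1 by rewrite /slope mulmorph1.
apply/le_anti/andP; split.
  apply: (bound_le C1 CB1); first exact: ltW.
    move=> k n; rewrite leNgt => kn; apply/negP => lt.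
    apply: (bole_ngt kn); have := @lex_affine_lt genb 1%g n k; rewrite conjg1; apply.
    by rewrite slopeB s1 mulr1.
  by move=> k n; apply: ratio_ge.
apply: (bound_le C1 CB1); first by apply/ltW/scale_gt0/pinched_arch.
  by move=> k n; apply: ratio_le.
move=> k n; rewrite leNgt => kn; apply/negP => lt.
apply: (bole_ngt kn); have := @lex_affine_lt 1%g genb k n; rewrite conjg1; apply.
by rewrite slopeB s1 mulr1.
Qed.

End Family.

(** * Orbit closures *)

Lemma automorphism_inverse (G : groupType) (s : automorphism G) :
  exists s' : {multiplicative G -> G}, cancel s s' /\ cancel s' s.
Proof.
have [t sK tK] := aut_bij s.
pose tM := isMultiplicative.Build G G t (can2_gmulfM sK tK).
by exists (HB.pack_for {multiplicative G -> G} t tM).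
Qed.

Lemma bolt_aut_act (G : groupType) (s : automorphism G) (o : biorder G) x y :
  bolt (aut_act s o) (s x) (s y) <-> bolt o x y.
Proof.
rewrite bolt_poscone poscone_aut_act bolt_poscone -mulmorphV -gmulfM.
split=> [[z oz /(bij_inj (aut_bij s)) <-] //|oxy]; by exists (x^-1 * y).
Qed.

Section OrbitClosure.
Variable R : realType.
Local Open Scope ring_scope.

Lemma orbit_scale (o : biorder F2) (s1 s2 : automorphism F2) :
  pinched (aut_act s1 o) -> pinched (aut_act s2 o) ->
  scale (aut_act s1 o) comm_ab R genb = scale (aut_act s2 o) comm_ab R genb.
Proof.
move=> p1 p2.
have [t1 [s1K t1K]] := automorphism_inverse s1.
have [t2 [s2K t2K]] := automorphism_inverse s2.
apply: (pinched_rigid (tau := s1 \o t2) (theta := s2 \o t1) p1 p2).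
- by move=> x /=; rewrite s1K t2K.
- by move=> x /=; rewrite s2K t1K.
move=> x y; have := bolt_aut_act s2 o (t2 x) (t2 y); rewrite !t2K => h.
exact: (iff_trans h (iff_sym (bolt_aut_act s1 o (t2 x) (t2 y)))).
Qed.

(** Any single comparison of powers of [c] and [c ^ b] true in a pinched [o] is true in some
   pinched order of [X]; so all of them constrain [r] as they constrain the scale of [o]. *)
Lemma closure_scale (X : set (biorder F2)) (o : biorder F2) (r : R) :
  pinched o -> closure X o ->
  (forall o', X o' -> pinched o' -> scale o' comm_ab R genb = r) ->
  scale o comm_ab R genb = r.
Proof.
move=> po clo Xr.
have [C1 CB1 _ _] := pinched_arch po genb.
have near_le x y : bole o x y ->
    exists o', [/\ pinched o', scale o' comm_ab R genb = r & bole o' x y].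
  case=> [->|/nbhs_bolt xy].
    have [o' [Xo' po']] := clo _ (nbhs_pinched po).
    by exists o'; split=> //; [exact: Xr | exact: bolexx].
  have [o' [Xo' [po' xy']]] := clo _ (filterI (nbhs_pinched po) xy).
  by exists o'; split=> //; [exact: Xr | exact: boltW].
have r0 : 0 <= r.
  have [o' [po' <- _]] := near_le comm_ab comm_ab (bolexx o comm_ab).
  exact/ltW/scale_gt0/pinched_arch.
apply/le_anti/andP; split.
  apply: (bound_le C1 CB1) => // k n; last by apply/ratio_ge/pinched_arch.
  case/near_le => o' [po' <-]; exact/ratio_le/pinched_arch.
apply: (bound_le C1 CB1).
- exact/ltW/scale_gt0/pinched_arch.
- by move=> k n; apply/ratio_le/pinched_arch.
move=> k n /near_le [o' [po' <-]]; exact/ratio_ge/pinched_arch.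
Qed.

End OrbitClosure.

Lemma itv_uncountable (R : realType) (a b : R) :
  (a < b)%R -> ~ countable [set` `]a, b[%R].
Proof.
move=> ab /countable_lebesgue_measure0.
rewrite lebesgue_measure_itv /= lte_fin ab => /eqP.
by rewrite -EFinB eqe subr_eq0 gt_eqF.
Qed.

Theorem theorem4 :
  ~ exists o : nat -> biorder F2,
      [set: biorder F2] = \bigcup_n closure (aut_orbit (o n)).
Proof.
case=> o cover.
pose R : realType := Rdefinitions.R.
pose E n := [set r : R | exists2 s, pinched (aut_act s (o n)) &
  r = scale (aut_act s (o n)) comm_ab R genb].
(* By rigidity, the pinched orders of one orbit share a single value. *)
have Ecount n : countable (E n).
  have [[r Er]|E0] := EM (exists r, E n r); last first.
    by apply: sub_countable (countable0 R); apply: subset_card_le => r /(ex_intro _ r).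
  apply: sub_countable (countable1 r); apply: subset_card_le => r' /=.
  case: Er => s ps -> [s' ps' ->]; exact: orbit_scale.
have itvE : [set` `]2%R, (5 / 2)%R[%R] `<=` \bigcup_n E n.
  move=> t /=; rewrite in_itv /= => t_itv.
  have t0 : (0 < t)%R by case/andP: t_itv => *; lra.
  have t1 : (1 < t)%R by case/andP: t_itv => *; lra.
  have pf := lex_affine_pinched (o 0) t0 t1 t_itv.
  have : [set: biorder F2] (lex_affine (o 0) t0) by [].
  rewrite cover => -[n _ cln]; exists n => //.
  have [o' [[s _ <-] ps]] := cln _ (nbhs_pinched pf).
  exists s => //; rewrite -(lex_affine_scale (o 0) t0 t1 t_itv).
  apply: closure_scale pf cln _ => _ [s' _ <-] ps'; exact: orbit_scale.
have lt : (2 < 5 / 2 :> R)%R by lra.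
apply: (itv_uncountable lt); apply: sub_countable (subset_card_le itvE) _.
exact: bigcup_countable.
Qed.
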